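(* Let $$f_{\mathrm{SSvM}}(\theta|\mu,\kappa,\lambda)=\frac{1}{2\pi I_0(\kappa)}\exp\{\kappa\cos(\theta-\mu)\}\{1+\lambda\sin(\theta-\mu)\}$$ be the density on the circle of the sine-skewed von Mises (SSvM) distribution, and let $\Gamma_{\mathrm{vM}}=\{(\mu,\kappa,\lambda)^T\mid0\le\mu<2\pi,\ \kappa>0,\ -1\le\lambda\le1\}$. Then the family $\{f_{\mathrm{SSvM}}(\theta|\mu,\kappa,\lambda)\mid(\mu,\kappa,\lambda)^T\in\Gamma_{\mathrm{vM}}\}$ is identifiable.
   Context: Here $\theta$ ranges over the circle (an interval of length $2\pi$, e.g. $[0,2\pi)$), and $I_\nu(\kappa)=\frac{1}{2\pi}\int_0^{2\pi}\cos(\nu\theta)\exp\{\kappa\cos\theta\}\,d\theta$ is the modified Bessel function of the first kind of order $\nu\in\mathbb{Z}$. Identifiability: a family $\{f(\cdot|\bm{\gamma})\mid\bm{\gamma}\in\Gamma\}$ of densities is identifiable if $\bm{\gamma}_1\neq\bm{\gamma}_2$ in $\Gamma$ implies that $f(\cdot|\bm{\gamma}_1)$ and $f(\cdot|\bm{\gamma}_2)$ define different distributions (different cumulative distribution functions; equivalently, the densities are not equal almost everywhere). *)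

(* Defs.v *)
From HB Require Import structures.
From mathcomp Require Import all_boot all_order all_algebra.
From mathcomp Require Import all_classical all_reals all_analysis.

Set Implicit Arguments.
Unset Strict Implicit.
Unset Printing Implicit Defensive.

Import Order.TTheory GRing.Theory Num.Theory.
Import numFieldNormedType.Exports.

Local Open Scope classical_set_scope.
Local Open Scope ring_scope.

Section Defs.
Context {R : realType}.

(* The circle is represented by the angles in [0, 2 pi). *)
Definition circle : set R := `[0, 2 * pi[.

(* Cumulative distribution function, with origin 0, of the law on the circle
   with density [f] with respect to Lebesgue measure.  The integral is
   extended-real valued; no density or integrability condition on [f] is built
   in. *)
Definition circular_cdf (f : R -> R) (x : R) : \bar R :=
  (\int[lebesgue_measure]_(t in circle `&` `]-oo, x]) (f t)%:E)%E.

Definition identifiable (P : Type) (Gamma : set P) (f : P -> R -> R) : Prop :=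
  forall g1 g2 : P, Gamma g1 -> Gamma g2 -> g1 <> g2 ->
    circular_cdf (f g1) <> circular_cdf (f g2).

Definition besselI (nu : int) (kappa : R) : R :=
  (2 * pi)^-1 *
  \int[lebesgue_measure]_(t in `[0, 2 * pi])
     (cos (nu%:~R * t) * expR (kappa * cos t)).

Definition fSSvM (mu kappa lambda theta : R) : R :=
  (2 * pi * besselI 0 kappa)^-1 * expR (kappa * cos (theta - mu)) *
  (1 + lambda * sin (theta - mu)).

(* Parameters are the triples (mu, kappa, lambda). *)
Definition GammavM : set (R * R * R) :=
  [set g | 0 <= g.1.1 < 2 * pi /\ 0 < g.1.2 /\ -1 <= g.2 <= 1].

End Defs.

(* Main.v *)
Require Import Defs.
From HB Require Import structures.
From mathcomp Require Import all_boot all_order all_algebra.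
From mathcomp Require Import all_classical all_reals all_analysis.
From mathcomp Require Import ring lra.

(** Equal distribution functions force the two densities to agree on the whole
    real line: both are continuous and 2 pi-periodic, so they can be recovered
    by differentiating the distribution function
    ([continuous_circular_cdf_inj], [periodic_eq_on_circle]).

    Write c = (2 pi I_0(kappa))^-1, which is positive.  Opposite points of the
    circle change the sign of both cos and sin, so in the product of the
    densities at theta and theta + pi the exponential factors cancel:
    f(theta) f(theta + pi) = c^2 (1 - lambda^2 sin^2(theta - mu))
    ([fSSvM_antipodal]).  This product is at most c^2, with equality at
    theta = mu.  If two triples give the same density, then at theta = mu1 the
    common product is c1^2 for the first triple and at most c2^2 for the second.
    By symmetry c1 = c2, and lambda2 sin(mu1 - mu2) = 0 because the equality
    case is attained ([fSSvM_eq_const], [fSSvM_eq_skew]).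

    At theta = mu1 the skewing factor is therefore 1 in both densities, and
    comparing the exponents there gives kappa1 = kappa2 cos(mu1 - mu2).  The
    same equation holds with the triples exchanged; since both kappas are
    positive, cos(mu1 - mu2) = 1 and kappa1 = kappa2.  Hence mu1 = mu2, because
    both lie in [0, 2 pi), and lambda is read off at theta = mu + pi/2. *)

Set Implicit Arguments.
Unset Strict Implicit.
Unset Printing Implicit Defensive.

Import Order.TTheory GRing.Theory Num.Theory.
Import numFieldNormedType.Exports.

Local Open Scope classical_set_scope.
Local Open Scope ring_scope.

Section CircularCdf.
Context {R : realType}.
Implicit Types (f g : R -> R) (t x : R).

Lemma continuous_itv_integrable f x : continuous f ->
  (@lebesgue_measure R).-integrable `[0, x] (EFin \o f).
Proof.
move=> cf; apply: continuous_compact_integrable; first exact: segment_compact.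
exact: continuous_subspaceT.
Qed.

Lemma circular_cdfE f x : x < 2 * pi ->
  fine (circular_cdf f x) = \int[lebesgue_measure]_(t in `[0, x]) f t.
Proof.
move=> x2pi; rewrite /circular_cdf /Rintegral; congr (fine (integral _ _ _)).
apply/seteqP; split=> t; rewrite /circle /= !in_itv /=.
  by move=> [/andP[-> _] ->].
by move=> /andP[-> tx]; rewrite tx (le_lt_trans tx x2pi).
Qed.

(** At an interior point the density is the derivative of the distribution
    function; at the origin, which is an endpoint of the fundamental domain, it
    is recovered as the limit of its values on the right. *)
Lemma continuous_circular_cdf_inj f g : continuous f -> continuous g ->
  circular_cdf f = circular_cdf g -> {in circle, f =1 g}.
Proof.
move=> cf cg fg.
have fgoo x : 0 < x -> x < 2 * pi -> f x = g x.
  move=> x0 x2pi.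
  have [_ <-] := continuous_FTC1_closed x2pi
    (continuous_itv_integrable (2 * pi) cf) x0 (cf x).
  have [_ <-] := continuous_FTC1_closed x2pi
    (continuous_itv_integrable (2 * pi) cg) x0 (cg x).
  rewrite !derive1E; apply: near_eq_derive.
  have : x \in `]-oo, 2 * pi[ by rewrite in_itv.
  move=> /near_in_itvNyo; apply: filterS => y; rewrite in_itv /= => y2pi.
  by rewrite -!circular_cdfE// fg.
move=> x; rewrite inE /circle /= in_itv /= => /andP[].
rewrite le_eqVlt => /predU1P[<- _|]; last exact: fgoo.
have f0 : f t @[t --> 0^'+] --> f 0 by apply: cvg_at_right_filter; exact: cf.
have g0 : g t @[t --> 0^'+] --> g 0 by apply: cvg_at_right_filter; exact: cg.
apply: (norm_cvg_unique f0); apply: cvg_trans g0; apply: near_eq_cvg.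
near=> t; rewrite -fgoo //.
near: t; apply: nbhs_right_lt; rewrite mulr_gt0// pi_gt0.
Unshelve. all: by end_near. Qed.

Lemma periodic_eq_on_circle f g :
  periodic f (pi *+ 2) -> periodic g (pi *+ 2) ->
  {in circle, f =1 g} -> f =1 g.
Proof.
move=> pf pg fg t.
have T0 : 0 < (pi : R) *+ 2 by rewrite pmulrn_lgt0 ?pi_gt0.
have /andP[nl nu] := floor_itv (t / (pi *+ 2)).
have : f (t - pi *+ 2 *~ Num.floor (t / (pi *+ 2))) =
       g (t - pi *+ 2 *~ Num.floor (t / (pi *+ 2))).
  apply: fg; rewrite inE /circle /= in_itv /= mulr_natl.
  move: nl nu; rewrite ler_pdivlMr// ltr_pdivrMr// intrD mulrDl mul1r !mulrzl.
  by rewrite subr_ge0 ltrBlDl => -> ->.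
case: (Num.floor _) => n; last by rewrite NegzE mulrNz opprK !periodicn.
move: (t - _) (subrK (pi *+ 2 *~ n) t) => s <-.
by rewrite -!pmulrn !periodicn.
Qed.

End CircularCdf.

Section SineSkewedVonMises.
Context {R : realType}.
Implicit Types (mu kappa lambda t x : R).

(** The integrand is bounded below by the positive constant exp(- kappa). *)
Lemma besselI0_gt0 kappa : 0 < kappa -> 0 < besselI 0 kappa.
Proof.
move=> kappa0; have pi2 : 0 < 2 * pi :> R by rewrite mulr_gt0 ?pi_gt0.
rewrite /besselI mulr_gt0 ?invr_gt0//.
apply: (@lt_le_trans _ _
    (\int[lebesgue_measure]_(t in `[0, 2 * pi]) expR (- kappa))).
  rewrite Rintegral_cst//= lebesgue_measure_itv/= lte_fin pi2 sube0/=.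
  by rewrite mulr_gt0 ?expR_gt0.
apply: le_Rintegral => //=.
- by apply: continuous_itv_integrable => x; exact: cvg_cst.
- apply: continuous_itv_integrable => x.
  apply: cvgM.
    apply: (@continuous_comp _ _ _ (fun t => 0%:~R * t) cos).
      exact: mulrl_continuous.
    exact: continuous_cos.
  apply: (@continuous_comp _ _ _ (fun t => kappa * cos t) expR).
    by apply: cvgM; [exact: cvg_cst|exact: continuous_cos].
  exact: continuous_expR.
- move=> x _; rewrite mulr0z mul0r cos0 mul1r ler_expR.
  by rewrite -mulrN1 ler_pM2l// cos_geN1.
Qed.

Lemma fSSvM_const_gt0 kappa : 0 < kappa -> 0 < (2 * pi * besselI 0 kappa)^-1.
Proof.
move=> k0; rewrite invr_gt0 mulr_gt0 ?besselI0_gt0//.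
by rewrite mulr_gt0 ?pi_gt0.
Qed.

Lemma continuous_fSSvM mu kappa lambda : continuous (fSSvM mu kappa lambda).
Proof.
move=> t; have shift : {for t, continuous (fun t => t - mu)}.
  by apply: cvgB; [exact: cvg_id|exact: cvg_cst].
apply: cvgM; first apply: cvgM; first exact: cvg_cst.
- apply: (@continuous_comp _ _ _ (fun t => kappa * cos (t - mu)) expR).
    apply: cvgM; first exact: cvg_cst.
    by apply: continuous_comp shift _; exact: continuous_cos.
  exact: continuous_expR.
- apply: cvgD; first exact: cvg_cst.
  apply: cvgM; first exact: cvg_cst.
  by apply: continuous_comp shift _; exact: continuous_sin.
Qed.

Lemma periodic_fSSvM mu kappa lambda :
  periodic (fSSvM mu kappa lambda) (pi *+ 2).
Proof. by move=> t; rewrite /fSSvM addrAC cosD2pi sinD2pi. Qed.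

(** Going to the opposite point negates cos and sin, so the two exponentials
    are inverse to each other. *)
Lemma fSSvM_antipodal mu kappa lambda t :
  fSSvM mu kappa lambda t * fSSvM mu kappa lambda (t + pi) =
  (2 * pi * besselI 0 kappa)^-1 ^+ 2 * (1 - (lambda * sin (t - mu)) ^+ 2).
Proof.
rewrite /fSSvM (addrAC t) cosDpi sinDpi !mulrN.
have e0 : expR (kappa * cos (t - mu)) != 0 by rewrite gt_eqF ?expR_gt0.
rewrite expRN; move: (_^-1) => c; by field.
Qed.

(** The two antipodal products are compared at [mu1], where the sine of the
    first density vanishes. *)
Lemma fSSvM_eq_const_sqr mu1 kappa1 lambda1 mu2 kappa2 lambda2 :
  fSSvM mu1 kappa1 lambda1 =1 fSSvM mu2 kappa2 lambda2 ->
  (2 * pi * besselI 0 kappa1)^-1 ^+ 2 =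
  (2 * pi * besselI 0 kappa2)^-1 ^+ 2 *
  (1 - (lambda2 * sin (mu1 - mu2)) ^+ 2).
Proof.
move=> eq_f; rewrite -(fSSvM_antipodal mu2) -!eq_f fSSvM_antipodal subrr sin0.
by rewrite mulr0 expr0n /= subr0 mulr1.
Qed.

Lemma fSSvM_le_const mu1 kappa1 lambda1 mu2 kappa2 lambda2 :
  0 < kappa1 -> 0 < kappa2 ->
  fSSvM mu1 kappa1 lambda1 =1 fSSvM mu2 kappa2 lambda2 ->
  (2 * pi * besselI 0 kappa1)^-1 <= (2 * pi * besselI 0 kappa2)^-1.
Proof.
move=> k1 k2 eq_f.
rewrite -(@ler_pXn2r _ 2) ?nnegrE ?(ltW (fSSvM_const_gt0 _))//.
by rewrite (fSSvM_eq_const_sqr eq_f) ler_piMr ?sqr_ge0// gerBl sqr_ge0.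
Qed.

Lemma fSSvM_eq_const mu1 kappa1 lambda1 mu2 kappa2 lambda2 :
  0 < kappa1 -> 0 < kappa2 ->
  fSSvM mu1 kappa1 lambda1 =1 fSSvM mu2 kappa2 lambda2 ->
  (2 * pi * besselI 0 kappa1)^-1 = (2 * pi * besselI 0 kappa2)^-1.
Proof.
move=> k1 k2 eq_f; apply/eqP; rewrite eq_le (fSSvM_le_const k1 k2 eq_f).
by rewrite (fSSvM_le_const k2 k1 (fsym eq_f)).
Qed.

Lemma fSSvM_eq_skew mu1 kappa1 lambda1 mu2 kappa2 lambda2 :
  0 < kappa1 -> 0 < kappa2 ->
  fSSvM mu1 kappa1 lambda1 =1 fSSvM mu2 kappa2 lambda2 ->
  lambda2 * sin (mu1 - mu2) = 0.
Proof.
move=> k1 k2 eq_f; have := fSSvM_eq_const_sqr eq_f.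
rewrite (fSSvM_eq_const k1 k2 eq_f) -[LHS]mulr1 => /mulfI.
rewrite gt_eqF ?exprn_gt0 ?fSSvM_const_gt0// => /(_ isT) e.
by apply/eqP; rewrite -sqrf_eq0; apply/eqP; lra.
Qed.

(** Both densities are evaluated at [mu1], where neither is skewed. *)
Lemma fSSvM_eq_concentration mu1 kappa1 lambda1 mu2 kappa2 lambda2 :
  0 < kappa1 -> 0 < kappa2 ->
  fSSvM mu1 kappa1 lambda1 =1 fSSvM mu2 kappa2 lambda2 ->
  kappa1 = kappa2 * cos (mu1 - mu2).
Proof.
move=> k1 k2 eq_f; have := eq_f mu1; rewrite /fSSvM.
rewrite (fSSvM_eq_skew k1 k2 eq_f) (fSSvM_eq_const k1 k2 eq_f).
rewrite subrr cos0 sin0 mulr0 addr0 !mulr1 => /mulfI.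
by rewrite gt_eqF ?fSSvM_const_gt0// => /(_ isT) /expR_inj.
Qed.

(** By the half-angle formula sin vanishes at |x| / 2, which lies in [0, pi). *)
Lemma cos_eq1_small x : `|x| < 2 * pi -> cos x = 1 -> x = 0.
Proof.
move=> x2pi; rewrite -cos_norm (splitr `|x|) -mulr2n cos_mulr2n cos2sin2 => cx.
apply/normr0_eq0/eqP; rewrite eq_le normr_ge0 andbT leNgt; apply/negP => x0.
have : 0 < sin (`|x| / 2) by apply: sin_gt0_pi; apply/andP; split; lra.
by move=> /(exprn_gt0 2); rewrite lt0r => /andP[/eqP]; lra.
Qed.

Lemma fSSvM_inj mu1 kappa1 lambda1 mu2 kappa2 lambda2 :
  GammavM (mu1, kappa1, lambda1) -> GammavM (mu2, kappa2, lambda2) ->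
  fSSvM mu1 kappa1 lambda1 =1 fSSvM mu2 kappa2 lambda2 ->
  (mu1, kappa1, lambda1) = (mu2, kappa2, lambda2).
Proof.
move=> [/= /andP[m10 m1pi] [k1 _]] [/= /andP[m20 m2pi] [k2 _]] eq_f.
have E1 := fSSvM_eq_concentration k1 k2 eq_f.
have E2 := fSSvM_eq_concentration k2 k1 (fsym eq_f).
have cosle := cos_le1 (mu1 - mu2).
rewrite -[mu2 - mu1]opprB cosN in E2.
have k12 : kappa1 = kappa2.
  by apply/eqP; rewrite eq_le; apply/andP; split;
    [rewrite E1|rewrite E2]; rewrite ger_pMr.
have cos1 : cos (mu1 - mu2) = 1.
  by apply: (mulfI (lt0r_neq0 k2)); rewrite -E1 mulr1.
have m12 : mu1 = mu2.
  apply/eqP; rewrite -subr_eq0; apply/eqP; apply: cos_eq1_small cos1.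
  by rewrite ltr_norml; apply/andP; split; lra.
(* Here the sine is 1, so the skewing factors are 1 + lambda1 and 1 + lambda2. *)
have := eq_f (mu2 + pi / 2).
rewrite /fSSvM m12 k12 (addrC mu2) addrK sin_pihalf !mulr1 => /mulfI.
rewrite mulf_neq0 ?gt_eqF ?expR_gt0 ?fSSvM_const_gt0// => /(_ isT) /addrI.
by move=> ->.
Qed.

End SineSkewedVonMises.

Theorem proposition4 (R : realType) :
  identifiable (@GammavM R) (fun g => fSSvM g.1.1 g.1.2 g.2).
Proof.
move=> [[mu1 kappa1] lambda1] [[mu2 kappa2] lambda2] G1 G2 neq eq_cdf.
apply/neq/fSSvM_inj => //.
apply: periodic_eq_on_circle; [exact: periodic_fSSvM..|].
by apply: continuous_circular_cdf_inj eq_cdf; exact: continuous_fSSvM.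
Qed.
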